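(* Let $c\ge 3$ and let $w\in W_c$ be a reduced billiard table word. The number of Seifert circles in the alternating diagram $D$ obtained from $w$ is at most two more than the number of all vertically-smoothed crossings of $D$.
   Context: Words. For $c\ge 3$, $W_c$ is the set of reduced billiard table words $w=(+)^{\varepsilon_1}(-)^{\varepsilon_2}(+)^{\varepsilon_3}(-)^{\varepsilon_4}\cdots$ in the alphabet $\{+,-\}$ consisting of exactly $c$ runs of alternating sign, starting with a $+$ run (so the last run is $(+)^{\varepsilon_c}$ for $c$ odd and $(-)^{\varepsilon_c}$ for $c$ even), with $\varepsilon_1=\varepsilon_c=1$, $\varepsilon_i\in\{1,2\}$ for $2\le i\le c-1$, and length $\ell=\sum_{i=1}^c\varepsilon_i\equiv 1\bmod 3$. Alternating diagram $D$ of $w$. Replace each run of $w$, from left to right, by one crossing: $(+)^1\mapsto\sigma_1$, $(+)^2\mapsto\sigma_2^{-1}$, $(-)^1\mapsto\sigma_2^{-1}$, $(-)^2\mapsto\sigma_1$. This gives a 3-strand braid word with $c$ letters, drawn left to right with strands at heights $1,2,3$ (bottom to top); $\sigma_i^{\pm1}$ is a crossing between heights $i$ and $i+1$ whose overstrand has slope $\pm1$. On the left, strand 1 is the left end of a long knot and strands 2, 3 are joined by a cap. On the right, if $c$ is odd, strands 2, 3 are joined and strand 1 is the right end; if $c$ is even, strands 1, 2 are joined and strand 3 is the right end. The result is a long knot diagram $D$ (closed up in the usual way when viewed as a knot diagram; the long component of a smoothing counts as one circle). Orient it from its left end. Smoothing types. A crossing of $D$ is vertically-smoothed if its two strands are both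 oriented upwards or both oriented downwards, and horizontally-smoothed if both are oriented to the left or both to the right. Seifert circles are the circles obtained by smoothing all crossings of $D$ according to the orientation (Seifert's algorithm). *)

(* Defs.v *)
From mathcomp Require Import all_boot all_fingroup.

Set Implicit Arguments.
Unset Strict Implicit.
Unset Printing Implicit Defensive.

(* Words in the alphabet {+, -} are boolean sequences: true is +, false is -. *)

Fixpoint word_of_exponents (s : bool) (eps : seq nat) : seq bool :=
  if eps is e :: eps' then nseq e s ++ word_of_exponents (~~ s) eps'
  else [::].

(* The exponent eps_i of the usual 1-based notation is nth 0 eps i.-1. *)
Definition billiard_word (c : nat) (w : seq bool) : Prop :=
  exists2 eps : c.-tuple nat, w = word_of_exponents true eps &
    [/\ nth 0 eps 0 = 1,
        nth 0 eps c.-1 = 1,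
        forall i, 0 < i < c.-1 -> nth 0 eps i = 1 \/ nth 0 eps i = 2 &
        size w = 1 %[mod 3]].

(* Maximal constant blocks of a word, each with its sign and its length. *)
Fixpoint runs (w : seq bool) : seq (bool * nat) :=
  if w is s :: w' then
    match runs w' with
    | (t, n) :: r => if s == t then (t, n.+1) :: r else (s, 1) :: (t, n) :: r
    | [::] => [:: (s, 1)]
    end
  else [::].

(* Heights 1, 2, 3 are the elements 0, 1, 2 of 'I_3.  The gap k : 'I_2 lies
   between the heights lift ord_max k (of value k) and lift ord0 k (of value
   k + 1). *)
Definition gap_height (k : 'I_2) (upper : bool) : 'I_3 :=
  if upper then lift ord0 k else lift ord_max k.

Definition gap_swap (k : 'I_2) : {perm 'I_3} :=
  tperm (gap_height k false) (gap_height k true).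

(* sigma_(k + 1) if over_rising, that is, if the overstrand has slope +1, and
   its inverse otherwise. *)
Record crossing := Crossing { gap : 'I_2; over_rising : bool }.

Definition sigma1 : crossing := Crossing ord0 true.
Definition sigma2V : crossing := Crossing ord_max false.

Definition run_crossing (r : bool * nat) : crossing :=
  match r with
  | (true, 1) | (false, 2) => sigma1
  | (true, 2) | (false, 1) => sigma2V
  | _ => sigma1 (* irrelevant: billiard words have no run longer than 2 *)
  end.

(* The crossings from left to right.  The caps are not recorded: they are
   determined by the number of crossings, see left_cap and right_cap. *)
Definition diagram := seq crossing.

Definition alternating_diagram (w : seq bool) : diagram :=
  map run_crossing (runs w).

Section Diagram.
Variable D : diagram.

(* The diagram is cut along the vertical lines before, between and after the
   crossings: crossing i lies between the lines lift ord_max i (of value i) and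
   lift ord0 i (of value i + 1). *)
Definition point : finType := ('I_(size D).+1 * 'I_3)%type.

Definition gap_at (i : 'I_(size D)) : 'I_2 := gap (tnth (in_tuple D) i).

(* A cap swaps the two heights that it joins and fixes the height of the end of
   the long knot. *)
Definition left_cap : {perm 'I_3} := gap_swap ord_max.
Definition right_cap : {perm 'I_3} :=
  gap_swap (if odd (size D) then ord_max else ord0).

(* One step of a traveller standing at a point and facing right (true) or left
   (false).  At an end of the long knot the traveller stops. *)
Definition step (s : point * bool) : point * bool :=
  let: (j, h, rightward) := s in
  if rightward then
    if unlift ord_max j is Some i then
      (lift ord0 i, gap_swap (gap_at i) h, true)
    else if right_cap h == h then s else (j, right_cap h, false)
  else
    if unlift ord0 j is Some i then
      (lift ord_max i, gap_swap (gap_at i) h, false)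
    else if left_cap h == h then s else (j, left_cap h, true).

(* The orientation: the journey that starts at the left end of the long knot
   passes through p in the given direction. *)
Definition passes (p : point) (rightward : bool) : bool :=
  fconnect step (ord0, ord0, true) (p, rightward).

(* The two strands of crossing i: slope +1 if rising, slope -1 otherwise. *)
Definition left_endpoint (i : 'I_(size D)) (rising : bool) : point :=
  (lift ord_max i, gap_height (gap_at i) (~~ rising)).
Definition right_endpoint (i : 'I_(size D)) (rising : bool) : point :=
  (lift ord0 i, gap_height (gap_at i) rising).

Definition goes_right (i : 'I_(size D)) (rising : bool) : bool :=
  passes (left_endpoint i rising) true.
Definition goes_left (i : 'I_(size D)) (rising : bool) : bool :=
  passes (right_endpoint i rising) false.

Definition goes_up (i : 'I_(size D)) (rising : bool) : bool :=
  if rising then goes_right i rising else goes_left i rising.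
Definition goes_down (i : 'I_(size D)) (rising : bool) : bool :=
  if rising then goes_left i rising else goes_right i rising.

Definition vertically_smoothed (i : 'I_(size D)) : bool :=
  (goes_up i true && goes_up i false) || (goes_down i true && goes_down i false).

Definition horizontally_smoothed (i : 'I_(size D)) : bool :=
  (goes_left i true && goes_left i false) ||
  (goes_right i true && goes_right i false).

Definition num_vertically_smoothed : nat :=
  #|[set i | vertically_smoothed i]|.

Definition strand_tail (i : 'I_(size D)) (rising : bool) : point :=
  if goes_right i rising then left_endpoint i rising
  else right_endpoint i rising.
Definition strand_head (i : 'I_(size D)) (rising : bool) : point :=
  if goes_right i rising then right_endpoint i rising
  else left_endpoint i rising.

(* Arcs of the smoothed diagram: Seifert's algorithm joins the incoming end of
   each strand of a crossing to the outgoing end of the other strand, and it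
   keeps the strand that passes above or below the crossing, and the caps. *)
Definition smoothed_arc (p q : point) : bool :=
  [|| [exists i, exists rising,
         (p == strand_tail i rising) && (q == strand_head i (~~ rising))],
      [exists i, [&& p.1 == lift ord_max i, q.1 == lift ord0 i, q.2 == p.2 &
                     gap_swap (gap_at i) p.2 == p.2]],
      [&& p.1 == ord0, q.1 == ord0 & q.2 == left_cap p.2] |
      [&& p.1 == ord_max, q.1 == ord_max & q.2 == right_cap p.2]].

(* The long component is the connected component of the left end; it counts as
   one circle. *)
Definition num_seifert_circles : nat :=
  n_comp [rel p q | smoothed_arc p q || smoothed_arc q p] predT.

End Diagram.

(* Main.v *)
Require Import Defs.
From mathcomp Require Import all_boot all_fingroup.

(** Read the smoothed diagram from left to right.  Away from its left end, a
    component of the smoothing has to start somewhere: follow it leftwards as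
    long as possible, and one ends on an arc that opens to the right.  There
    are few such arcs.  Apart from the left cap, only the right half of a
    smoothing of the form [)(] opens to the right, and such a smoothing arises
    exactly when the two strands of the crossing run in opposite horizontal
    directions, that is, when both go up or both go down.  So every component
    meets the left end of the long knot, the left cap, or the right half of a
    vertical smoothing (lemma [reaches_opening]), whence the bound.

    This uses that the orientation reaches every strand, that is, that [D] is a
    knot and not a link with more components; here the hypothesis on the length
    of the word comes in.  Forget the over- and undercrossings, and let [pi] be
    the permutation of the heights made by the three strands.  If the strand
    that starts at the left end arrives at the middle height, it does not stop
    at the right cap, but returns along a second strand, turns around at the
    left cap, and runs along the third one (lemma [traversed]).  It does arrive
    there: after a prefix of [L] letters made of whole runs, its height depends
    on [L] modulo 3 and on the sign of the next run only (lemma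
    [strand_of_left_end]), and for [L] = 1 modulo 3 this is the middle height
    for both signs. *)

(** * Strands of the braid *)

(** A product of permutations applies its leftmost factor first, so this sends
    the height of a strand at column 0 to its height at column [j]. *)
Definition braid_perm (D : diagram) (j : nat) : {perm 'I_3} :=
  (\prod_(x <- take j D) gap_swap (gap x))%g.

Lemma braid_perm0 D h : braid_perm D 0 h = h.
Proof. by rewrite /braid_perm take0 big_nil perm1. Qed.

Lemma braid_permS D (i : 'I_(size D)) h :
  braid_perm D i.+1 h = gap_swap (gap_at i) (braid_perm D i h).
Proof.
rewrite /braid_perm /gap_at (tnth_nth sigma1) /= (take_nth sigma1) //.
by rewrite -cats1 big_cat big_seq1 permM.
Qed.

Lemma gap_swapK k : involutive (gap_swap k).
Proof. exact: tpermK. Qed.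

Lemma gap_swap_height k b : gap_swap k (gap_height k b) = gap_height k (~~ b).
Proof. by case: b; rewrite /gap_swap ?tpermL ?tpermR. Qed.

Lemma gap_max_height {h : 'I_3} : h != ord0 -> exists b, h = gap_height ord_max b.
Proof.
case: h => [[|[|[|//]]] ?] // _; [exists false | exists true]; exact: val_inj.
Qed.

Lemma travel_right D (j : 'I_(size D).+1) h :
  fconnect (@step D) (ord0, h, true) (j, braid_perm D j h, true).
Proof.
case: j => j; elim: j => [|j IHj] ltj.
  rewrite braid_perm0 (_ : Ordinal ltj = ord0) ?connect0 //; exact: val_inj.
apply: connect_trans (IHj (ltnW ltj)) _.
pose i := @Ordinal (size D) j ltj.
have -> : Ordinal (ltnW ltj) = lift ord_max i by apply: ord_inj; rewrite lift_max.
have -> : Ordinal ltj = lift ord0 i by apply: val_inj.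
by apply: connect1; apply/eqP; rewrite /step liftK lift_max lift0 braid_permS.
Qed.

Lemma travel_left D (j : 'I_(size D).+1) h :
  fconnect (@step D) (ord_max, braid_perm D (size D) h, false)
    (j, braid_perm D j h, false).
Proof.
have [m] := ubnP (size D - j); elim: m j => // m IHm j ltm.
have [ltj|] := boolP (j < size D); last first.
  rewrite -leqNgt => lej; have Ej : j = ord_max.
    by apply: val_inj; apply/eqP; rewrite eqn_leq lej -ltnS ltn_ord.
  by rewrite Ej connect0.
pose i := Ordinal ltj.
have -> : j = lift ord_max i by apply: ord_inj; rewrite lift_max.
apply: connect_trans (IHm (lift ord0 i) _) _.
  by rewrite lift0 subnS -ltnS prednK // subn_gt0.
apply: connect1; apply/eqP.
by rewrite /step liftK lift_max lift0 braid_permS gap_swapK.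
Qed.

(** The journey runs along one strand rightwards, along a second one back, and
    along the third one rightwards again, so it meets every height in every
    column. *)
Lemma traversed D (i : 'I_(size D)) rising :
    right_cap D (braid_perm D (size D) ord0) != braid_perm D (size D) ord0 ->
  goes_right i rising || goes_left i rising.
Proof.
set n := size D => turns.
(* Height at column 0 of the strand on which the journey returns. *)
pose a := ((braid_perm D n)^-1 (right_cap D (braid_perm D n ord0)))%g.
have aP : braid_perm D n a = right_cap D (braid_perm D n ord0).
  by rewrite /a permKV.
have a_neq0 : a != ord0 by apply: contraNneq turns => a0; rewrite -aP a0.
have [b aE] := gap_max_height a_neq0.
have turns_left : left_cap a != a.
  by rewrite aE /left_cap gap_swap_height; case: (b).
have start_back : fconnect (@step D) (ord0, ord0, true)
    (ord_max, braid_perm D n a, false).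
  apply: connect_trans (travel_right D ord_max ord0) _.
  by apply: connect1; apply/eqP; rewrite /= unlift_none (negbTE turns) aP.
have back (j : 'I_n.+1) : passes (j, braid_perm D j a) false.
  exact: connect_trans start_back (travel_left D j a).
have out (j : 'I_n.+1) : passes (j, braid_perm D j ord0) true by apply: travel_right.
have again (j : 'I_n.+1) : passes (j, braid_perm D j (left_cap a)) true.
  apply: connect_trans (travel_right D j (left_cap a)).
  apply: connect_trans (back ord0) _; rewrite braid_perm0.
  by apply: connect1; apply/eqP; rewrite /= unlift_none (negbTE turns_left).
have strands h : [|| h == ord0, h == a | h == left_cap a].
  rewrite aE /left_cap gap_swap_height -implyNb; apply/implyP.
  by case/gap_max_height=> b' ->; case: (b); case: b'.
pose h := ((braid_perm D i)^-1 (gap_height (gap_at i) (~~ rising)))%g.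
have leftE : left_endpoint i rising = (lift ord_max i, braid_perm D (lift ord_max i) h).
  by rewrite lift_max permKV.
have rightE : right_endpoint i rising = (lift ord0 i, braid_perm D (lift ord0 i) h).
  by rewrite lift0 braid_permS permKV gap_swap_height negbK.
rewrite /goes_right /goes_left leftE rightE.
by have /or3P[] := strands h => /eqP->; rewrite ?out ?back ?again ?orbT.
Qed.

(** * The diagram of a word is a knot *)

Fixpoint alternating_runs (s : bool) (eps : seq nat) : seq (bool * nat) :=
  if eps is e :: eps' then (s, e) :: alternating_runs (~~ s) eps' else [::].

Lemma runs_word s eps : all (mem [:: 1; 2]) eps ->
  runs (word_of_exponents s eps) = alternating_runs s eps.
Proof.
elim: eps s => //= e eps IHeps s /andP[]; rewrite !inE => e12 /IHeps Hr.
have {IHeps}:= Hr (~~ s).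
by case/orP: e12 => /eqP-> /= ->; case: eps {Hr} => [|e' eps] /=;
  rewrite ?eqxx //; case: s.
Qed.

Lemma size_word s eps : size (word_of_exponents s eps) = sumn eps.
Proof. by elim: eps s => //= e eps IH s; rewrite size_cat size_nseq IH. Qed.

(** Height of the strand of the left end after whole runs of total length [L],
    when [s] is the sign of the next run: the two signs are exchanged by the
    reflection of the heights. *)
Definition left_end_height (s : bool) (L : nat) : 'I_3 :=
  if s then inord (L %% 3) else rev_ord (inord (L %% 3)).

(** A run of [e] letters adds [e] to [L] and changes the sign; each of the
    twelve cases is one transposition of two adjacent heights. *)
Lemma left_end_height_run s L e : e \in [:: 1; 2] ->
  gap_swap (gap (run_crossing (s, e))) (left_end_height s L)
    = left_end_height (~~ s) (L + e).
Proof.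
rewrite !inE /left_end_height /gap_swap => e12; rewrite -modnDml.
have : L %% 3 < 3 by rewrite ltn_mod.
case: (L %% 3) => [|[|[|]]] // _; case/orP: e12 => /eqP->; case: s;
  apply: val_inj; rewrite permE /= -?val_eqE /=; do 3?rewrite inordK //=.
Qed.

Lemma strand_of_left_end s L eps : all (mem [:: 1; 2]) eps ->
  (\prod_(x <- map run_crossing (alternating_runs s eps)) gap_swap (gap x))%g
    (left_end_height s L) = left_end_height (s (+) odd (size eps)) (L + sumn eps).
Proof.
elim: eps s L => [|e eps IH] s L /=; first by rewrite big_nil perm1 addbF addn0.
case/andP=> e12 eps12; rewrite big_cons permM left_end_height_run // IH //.
by rewrite addnA addbN addNb.
Qed.

(** The strand of the left end arrives at the middle height, which both possible
    right caps move. *)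
Lemma billiard_word_turns c w (D := alternating_diagram w) : billiard_word c w ->
  right_cap D (braid_perm D (size D) ord0) != braid_perm D (size D) ord0.
Proof.
rewrite {}/D; case=> eps -> [eps0 epsc epsi]; rewrite size_word => len.
have eps12 : all (mem [:: 1; 2]) eps.
  apply/(all_nthP 0) => i; rewrite size_tuple => ltic; rewrite !inE.
  have [->|i_gt0] := posnP i; first by rewrite eps0.
  have [->|i_neq] := eqVneq i c.-1; first by rewrite epsc.
  have [] := epsi i; [|by move=> ->..].
  by rewrite i_gt0 ltn_neqAle i_neq -ltnS (ltn_predK ltic).
rewrite /braid_perm take_size /alternating_diagram runs_word //.
have -> : ord0 = left_end_height true 0 by apply: val_inj; rewrite /= inordK.
rewrite strand_of_left_end // /left_end_height len.
set s := true (+) _; set h := (if s then _ else _).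
have -> : h = lift ord0 ord0.
  by apply: val_inj; rewrite /h; case: (s); rewrite /= inordK.
by rewrite /right_cap; case: ifP => _; rewrite -val_eqE /gap_swap permE.
Qed.

(** * Counting components of the smoothing *)

Lemma leq_n_comp {T : finType} (e : rel T) (S : {set T}) :
    connect_sym e -> (forall x, exists2 y, y \in S & connect e x y) ->
  n_comp e predT <= #|S|.
Proof.
move=> symE reach; apply: leq_trans (leq_imset_card (root e) _).
apply/subset_leq_card/subsetP => x; rewrite inE => /andP[/eqP rx _].
have [y yS /(rootP symE) Exy] := reach x.
by apply/imsetP; exists y; rewrite // -Exy rx.
Qed.

Definition smoothing (D : diagram) : rel (point D) :=
  [rel p q | smoothed_arc p q || smoothed_arc q p].

Lemma smoothing_sym D : connect_sym (@smoothing D).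
Proof. by apply: sym_connect_sym => p q; rewrite /smoothing /= orbC. Qed.

Lemma smoothing_strands D (i : 'I_(size D)) rising :
  smoothing D (strand_tail i rising) (strand_head i (~~ rising)).
Proof.
apply/orP; left; apply/or4P; apply: Or41.
by apply/existsP; exists i; apply/existsP; exists rising; rewrite !eqxx.
Qed.

(** Representatives of the arcs that open to the right: the left end, the left
    cap, and one point on the right half of each vertical smoothing. *)
Definition openings (D : diagram) : {set point D} :=
  [set (ord0, ord0); (ord0, gap_height ord_max true)] :|:
  [set right_endpoint i true | i in [set i | vertically_smoothed i]].

Lemma card_openings D : #|openings D| <= num_vertically_smoothed D + 2.
Proof.
rewrite addnC; apply: leq_trans (leq_card_setU _ _) _.
by apply: leq_add; rewrite ?leq_imset_card // cards2; case: eqP.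
Qed.

(** The step to the left that pushes a point towards an opening.  The smoothing
    depends only on which of the two strands go right.  If both or neither do,
    its arcs cross from one side to the other; if just one does, the other one
    goes left, so the crossing is vertically smoothed, and its right half joins
    the two right endpoints. *)
Lemma crossing_left D (i : 'I_(size D)) rising :
    (forall r, goes_right i r || goes_left i r) ->
  (exists h, connect (@smoothing D) (right_endpoint i rising) (lift ord_max i, h))
  \/ vertically_smoothed i /\
     connect (@smoothing D) (right_endpoint i rising) (right_endpoint i true).
Proof.
move=> trav; have := smoothing_strands D i false; have := smoothing_strands D i true.
have := trav false; have := trav true; rewrite /vertically_smoothed.
rewrite /strand_tail /strand_head /goes_up /goes_down [~~ true]/= [~~ false]/=.
case: (goes_right i true); case: (goes_right i false) => /= Gt Gf arcT arcF.
- left; exists (left_endpoint i (~~ rising)).2.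
  by rewrite smoothing_sym connect1 //; case: (rising).
- right; rewrite Gf; split=> //.
  by case: rising; [exact: connect0 | exact: connect1].
- right; rewrite Gt; split=> //.
  by case: rising; [exact: connect0 | rewrite smoothing_sym; exact: connect1].
- left; exists (left_endpoint i (~~ rising)).2.
  by rewrite connect1 //; case: (rising).
Qed.

Lemma reaches_opening D :
    (forall (i : 'I_(size D)) r, goes_right i r || goes_left i r) ->
  forall p : point D, exists2 q, q \in openings D & connect (@smoothing D) p q.
Proof.
move=> trav [[j ltj] h]; elim: j ltj h => [|j IHj] ltj h.
  have -> : Ordinal ltj = ord0 by apply: val_inj.
  have [->|h_neq0] := eqVneq h ord0.
    by exists (ord0, ord0); rewrite ?connect0 // !inE eqxx.
  have [[] ->] := gap_max_height h_neq0;
    exists (ord0, gap_height ord_max true); rewrite ?inE ?eqxx ?orbT ?connect0 //.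
  apply: connect1; apply/orP; left; apply/or4P; apply: Or43.
  by apply/and3P; split=> //; apply/eqP; rewrite [RHS]gap_swap_height.
pose i := @Ordinal (size D) j ltj.
have Ei : Ordinal ltj = lift ord0 i by apply: val_inj.
(* It suffices to join the point to the previous column. *)
have back h' : connect (@smoothing D) (lift ord0 i, h) (lift ord_max i, h') ->
    exists2 q, q \in openings D & connect (@smoothing D) (Ordinal ltj, h) q.
  have [q qS] := IHj (ltnW ltj) h'; rewrite Ei.
  have -> : Ordinal (ltnW ltj) = lift ord_max i.
    by apply: ord_inj; rewrite lift_max.
  by move=> cq ch; exists q; rewrite ?(connect_trans ch cq).
have [fixh|moved] := eqVneq (gap_swap (gap_at i) h) h.
  apply: (back h); rewrite smoothing_sym; apply: connect1; apply/orP; left.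
  apply/or4P; apply: Or42; apply/existsP; exists i.
  by rewrite /= !eqxx fixh eqxx.
have [rising Eh] : exists r, h = gap_height (gap_at i) r.
  move: moved; rewrite /gap_swap; case: tpermP => [->|->|_ _]; last by rewrite eqxx.
    by exists false.
  by exists true.
have := crossing_left D i rising (trav i); rewrite /right_endpoint -Eh.
case=> [[h' /back] // | [vert arc]].
exists (right_endpoint i true); last by rewrite Ei.
by apply/setUP; right; apply: imset_f; rewrite inE.
Qed.

Theorem corollary3p6 (c : nat) (w : seq bool) (hc : 3 <= c)
    (hw : billiard_word c w) :
  num_seifert_circles (alternating_diagram w)
    <= num_vertically_smoothed (alternating_diagram w) + 2.
Proof.
apply: leq_trans (card_openings _); apply: leq_n_comp (@smoothing_sym _) _.
by apply: reaches_opening => i r; apply/traversed/billiard_word_turns/hw.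
Qed.
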